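(* For each integer $n\ge2$, the ascent generating polynomial of Riordan sequences $\mathrm{asc}_{\mathcal{RP}(n)}(t)=\sum_{\mathbf w\in\mathcal{RP}(n)}t^{\mathrm{asc}(\mathbf w)}$ satisfies $$\mathrm{asc}_{\mathcal{RP}(n)}(t)=\sum_{i=1}^{\lfloor (n-1)/2\rfloor}\frac1i\binom{n-1}{i-1}\binom{n-2-i}{i-1}t^i=t\cdot{}_3F_2\!\left(1-n,\frac{3-n}{2},\frac{4-n}{2};2,3-n;4t\right).$$
   Context: $\mathcal{RP}(n)$ is the set of Riordan sequences of size $n$: sequences $\mathbf w=(w_1,\dots,w_n)$ of positive integers with $w_1=w_n=1$, $|w_i-w_{i+1}|\le1$ for $1\le i<n$, and no index $i$ with $w_i=w_{i+1}=1$. $\mathrm{asc}(\mathbf w)$ is the number of indices $i\in\{1,\dots,n-1\}$ with $w_i<w_{i+1}$. ${}_3F_2(a_1,a_2,a_3;b_1,b_2;z)=\sum_{k\ge0}\frac{(a_1)_k(a_2)_k(a_3)_k}{(b_1)_k(b_2)_k}\frac{z^k}{k!}$ is the generalized hypergeometric function, where $(a)_k=a(a+1)\cdots(a+k-1)$.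
   Formalization: The hypergeometric equality is stated only for n ≥ 3: at n = 2 it fails as printed, since RP(2) is empty (polynomial 0) while t·₃F₂(−1, 1/2, 1; 2, 1; 4t) = t − t²; the first equality is kept for all n ≥ 2. *)

(* Defs.v *)
From HB Require Import structures.
From mathcomp Require Import all_boot all_order all_algebra.
From mathcomp Require Import all_classical all_reals.
From mathcomp Require Import topology normedtype sequences.
From mathcomp Require Import zify.

Set Implicit Arguments.
Unset Strict Implicit.
Unset Printing Implicit Defensive.

Import Order.TTheory GRing.Theory Num.Theory.
Import numFieldNormedType.Exports.

Local Open Scope classical_set_scope.
Local Open Scope ring_scope.

(* The term w_i of the mathematical, 1-based, sequence is [nth 0 w i.-1]. *)
Definition riordan_seqs (n : nat) : set (seq nat) :=
  [set w | [/\ size w = n,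
             (forall i, (i < n)%N -> (0 < nth 0%N w i)%N),
             nth 0%N w 0 = 1%N /\ nth 0%N w n.-1 = 1%N,
             (forall i, (i.+1 < n)%N ->
                `|(nth 0%N w i)%:Z - (nth 0%N w i.+1)%:Z| <= 1 :> int) &
             ~ exists2 i, (i.+1 < n)%N &
                 nth 0%N w i = 1%N /\ nth 0%N w i.+1 = 1%N]].

Definition asc (w : seq nat) : nat :=
  count (fun i => nth 0 w i < nth 0 w i.+1)%N (iota 0 (size w).-1).

(* The sum below is over a classical set, and would be 0 by convention if it
   had infinitely many nonzero terms; this lemma rules that out. *)
Lemma finite_riordan_seqs (n : nat) : finite_set (riordan_seqs n).
Proof.
have bnd w : riordan_seqs n w -> forall i, (i < n)%N -> (nth 0%N w i <= i.+1)%N.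
  move=> [_ _ [w0 _] step _]; elim=> [|i IHi] lt_in; first by rewrite w0.
  by have := step i lt_in; have := IHi (ltnW lt_in); lia.
apply: (@sub_finite_set _ _
  ((fun u : n.-tuple 'I_n.+1 => map val u) @` setT)); last first.
  exact/finite_image/finite_finset.
move=> w Rw; have [sw _ _ _ _] := Rw.
have sz : size (map (@inord n) w) == n by rewrite size_map sw.
exists (Tuple sz) => //=; rewrite -map_comp.
apply: (@eq_from_nth _ 0%N) => [|i]; first by rewrite size_map.
rewrite size_map => lt_i; rewrite (nth_map 0%N) //=.
by rewrite inordK // ltnS (leq_trans (bnd w Rw i _)) // -sw.
Qed.

Definition asc_poly (K : numFieldType) (n : nat) : {poly K} :=
  \sum_(w \in riordan_seqs n) ('X^(asc w) : {poly K}).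

Definition pochhammer (K : numFieldType) (a : K) (k : nat) : K :=
  \prod_(i < k) (a + i%:R).

(* Since x / 0 = 0 in K, a term whose numerator vanishes is 0 even when its
   denominator vanishes as well: this is the usual convention for terminating
   hypergeometric series with a nonpositive integer lower parameter. *)
Definition hyp3F2_term (K : numFieldType) (a1 a2 a3 b1 b2 z : K) (k : nat) : K :=
  (pochhammer a1 k * pochhammer a2 k * pochhammer a3 k)
    / (pochhammer b1 k * pochhammer b2 k) * (z ^+ k / k`!%:R).

Definition hyp3F2 (K : numFieldType) (a1 a2 a3 b1 b2 z : K) : K :=
  limn (series (hyp3F2_term a1 a2 a3 b1 b2 z)).

(* Main.v *)
(** A Riordan sequence is a Motzkin-type walk on the positive integers, from 1 to
    1, without level steps at 1.  More generally, the walks from h + 1 to 1 with u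
    up steps, d = u + h down steps and l level steps, none of them at 1, number
      C(u+d+l, u) C(d+l-1, l) - C(u+d+l, u-1) C(d+l, l).
    This expression satisfies the recurrence obtained by removing the first step,
    by Pascal's rule away from height 1 and by an absorption identity at height 1,
    where only an up step is allowed.  For h = 0 it collapses to the coefficient of
    the theorem.  In the hypergeometric series the two half-integer parameters
    merge through (a/2)_k ((a+1)/2)_k 4^k = (a)_(2k), and each term becomes such a
    coefficient. *)

Require Import Defs.
From mathcomp Require Import all_boot all_order all_algebra.
From mathcomp Require Import all_classical all_reals.
From mathcomp Require Import topology normedtype sequences.
From mathcomp Require Import zify ring.
Import Order.TTheory GRing.Theory Num.Theory.
Import numFieldNormedType.Exports.
Local Open Scope classical_set_scope.
Local Open Scope ring_scope.

(** * Riordan sequences as walks from 1 to 1 *)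

(* From 1 only 2 is reachable: 0 is not allowed and level steps at 1 are forbidden. *)
Definition succs (a : nat) : seq nat :=
  if a == 1%N then [:: 2%N] else [:: a.+1; a; a.-1].

(** The lists omit the starting height [a], so their length is the number of steps and the recursion
    peels off the first step. *)
Fixpoint walks (m a : nat) : seq (seq nat) :=
  if m is m'.+1 then [seq b :: p | b <- succs a, p <- walks m' b]
  else if a == 1%N then [:: [::]] else [::].

Lemma mem_walks (m a : nat) (p : seq nat) :
  (p \in walks m a) =
  [&& size p == m, path (fun x y => y \in succs x) a p & last a p == 1%N].
Proof.
elim: m a p => [|m IHm] a [|b p] /=.
- by case: eqP.
- by case: eqP => _; rewrite ?inE.
- by apply/negbTE/allpairsPdep => -[b [q [_ _]]].
rewrite eqSS; apply/allpairsPdep/idP => [[c [q [ac qc [-> ->]]]]|].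
  by move: qc; rewrite IHm ac.
by case/and3P=> sp /andP[ab pb] lp; exists b, p; rewrite IHm sp pb lp.
Qed.

(** Positivity matters: [succs 0] would list 0 twice. Uniqueness is what turns the sum over the set
    into a sum over a list. *)
Lemma uniq_walks (m a : nat) : (0 < a)%N -> uniq (walks m a).
Proof.
elim: m a => [|m IHm] a a_gt0 /=; first by case: eqP.
have succs_gt0 b : b \in succs a -> (0 < b)%N.
  by rewrite /succs; case: eqP => [_|]; rewrite !inE; lia.
apply: allpairs_uniq_dep => [|b ab|]; last by move=> [b p] [c q] _ _ /= [-> ->].
  by rewrite /succs; case: eqP => //= _; rewrite !inE; lia.
exact/IHm/succs_gt0.
Qed.

Lemma riordan_seqsE (n : nat) : (2 <= n)%N ->
  riordan_seqs n = [set` [seq 1%N :: p | p <- walks n.-1 1]].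
Proof.
case: n => [//|[//|n]] _; apply/seteqP; split=> w /=.
- move=> [sw wpos [w0 wl] st no11].
  case: w sw w0 wl wpos st no11 => [//|a p] /= [sp] -> wl wpos st no11.
  apply: map_f; rewrite [_ \in _](mem_walks n.+1 1) sp eqxx /=; apply/andP; split.
    apply/(pathP 0%N) => i; rewrite sp => lt_i /=.
    have := st i lt_i; have := wpos i (ltnW lt_i); have /= := wpos i.+1 lt_i.
    have : ~ (nth 0%N (1%N :: p) i = 1%N /\ nth 0%N p i = 1%N).
      by move=> h; apply: no11; exists i.
    by rewrite /succs; case: eqP => [-> | ?]; rewrite !inE; lia.
  by rewrite -wl (last_nth 0%N) sp.
move=> /mapP[p]; rewrite [_ \in _](mem_walks n.+1 1) => /and3P[/eqP sp /(pathP 0%N) pp lp] ->.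
rewrite sp in pp.
(* Positivity propagates from the start because a walk at 1 can only move to 2. *)
have wpos i : (i < n.+2)%N -> (0 < nth 0%N (1%N :: p) i)%N.
  elim: i => [//|i IHi] lt_i; have := pp i lt_i; have := IHi (ltnW lt_i).
  by rewrite /succs; case: eqP => [-> | ?]; rewrite !inE /=; lia.
split => //=.
- by rewrite sp.
- by split=> //; rewrite -(eqP lp) (last_nth 0%N) sp.
- move=> i lt_i; have := pp i lt_i; have := wpos i (ltnW lt_i).
  by rewrite /succs; case: eqP => [-> | ?]; rewrite !inE /=; lia.
- move=> [i lt_i /= [e1 e2]]; have := pp i lt_i.
  by rewrite /succs e1 e2.
Qed.

(** * The ascent polynomial of walks and its recurrence *)

Lemma asc_cons2 (a b : nat) (p : seq nat) :
  asc (a :: b :: p) = ((a < b) + asc (b :: p))%N.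
Proof.
rewrite /asc /=; congr (_ + _)%N.
by rewrite -[1%N]addn0 iotaDl count_map.
Qed.

Definition walk_poly (K : numFieldType) (m a : nat) : {poly K} :=
  \sum_(p <- walks m a) 'X^(asc (a :: p)).

Lemma asc_poly_walk (K : numFieldType) (n : nat) : (2 <= n)%N ->
  asc_poly K n = walk_poly K n.-1 1.
Proof.
move=> n_ge2; rewrite /asc_poly riordan_seqsE // -fsbig_seq ?big_map //.
by rewrite map_inj_uniq ?uniq_walks // => p q [].
Qed.

Lemma walk_polyS (K : numFieldType) (m a : nat) :
  walk_poly K m.+1 a = \sum_(b <- succs a) 'X^(a < b)%N * walk_poly K m b.
Proof.
rewrite /walk_poly big_allpairs_dep; apply: eq_bigr => b _.
by rewrite mulr_sumr; apply: eq_bigr => p _; rewrite asc_cons2 exprD.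
Qed.

Lemma coef_walk_polyS1 (K : numFieldType) (m u : nat) :
  (walk_poly K m.+1 1)`_u = if u is u'.+1 then (walk_poly K m 2)`_u' else 0.
Proof. by rewrite walk_polyS big_seq1 coefXnM; case: u => //= u; rewrite subn1. Qed.

Lemma coef_walk_polyS (K : numFieldType) (m h u : nat) :
  (walk_poly K m.+1 h.+2)`_u =
    (if u is u'.+1 then (walk_poly K m h.+3)`_u' else 0)
    + (walk_poly K m h.+2)`_u + (walk_poly K m h.+1)`_u.
Proof.
rewrite walk_polyS !big_cons big_nil !coefD coef0 addr0 addrA !coefXnM.
rewrite ltnSn ltnn (_ : (h.+2 < h.+2.-1)%N = false) ?subn0; last by lia.
by case: u => //= u; rewrite subn1.
Qed.

(** * The closed form for the number of walks *)

(* Truncated subtraction makes [(d + l).-1 = 0] when d = l = 0, which gives the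
   empty walk its count 1. *)
Definition ballot (K : numFieldType) (u d l : nat) : K :=
  'C(u + d + l, u)%:R * 'C((d + l).-1, l)%:R
  - (if u is u'.+1 then 'C(u + d + l, u')%:R else 0) * 'C(d + l, l)%:R.

(** At height 1 only an up step is possible, so dropping it must preserve the count. By Pascal's
    rule the difference of the two sides is that of the products in [e]; these agree by absorption,
    since [u.+1] times either is [(u + l).+1 * 'C(s, u) * 'C(u + l, l)]. *)
Lemma ballot_diag (K : numFieldType) (u l : nat) :
  ballot K u.+1 u.+1 l = ballot K u u.+1 l.
Proof.
rewrite /ballot !addSn /=; set s := (u + u.+1 + l)%N.
have e1 : (u.+1 * 'C((u + l).+1, l) = (u + l).+1 * 'C(u + l, l))%N.
  by rewrite (mul_bin_down (u + l).+1) -addSn addnK.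
have e2 : (u.+1 * 'C(s, u.+1) = (u + l).+1 * 'C(s, u))%N.
  by rewrite mul_bin_left /s; congr (_ * _)%N; lia.
have e : ('C(s, u.+1) * 'C(u + l, l) = 'C(s, u) * 'C((u + l).+1, l))%N.
  apply/eqP; rewrite -(eqn_pmul2l (ltn0Sn u)) mulnA e2 mulnCA e1.
  by apply/eqP; ring.
have := congr1 (fun k => k%:R : K) e; rewrite !natrM => /eqP.
rewrite -subr_eq0 => /eqP eK; apply/eqP; rewrite -subr_eq0; apply/eqP.
apply: etrans eK.
by clearbody s; case: u {e1 e2 e} => [|u]; rewrite ?(bin0, binS) ?natrD; ring.
Qed.

Lemma ballot_rec (K : numFieldType) (u d l : nat) :
  ballot K u d.+1 l =
    (if u is u'.+1 then ballot K u' d.+1 l else 0)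
    + (if l is l'.+1 then ballot K u d.+1 l' else 0) + ballot K u d l.
Proof.
rewrite /ballot; case: l => [|l]; case: u => [|[|u]];
  rewrite ?(addSn, addnS, addn0, add0n, bin0, binS, bin1, binn) /= ?natrD; ring.
Qed.

Lemma walk_poly0 (K : numFieldType) (h : nat) :
  walk_poly K 0 h.+1 = (h == 0%N)%:R.
Proof.
by rewrite /walk_poly /= eqSS; case: eqP => [->|_]; rewrite ?big_seq1 ?big_nil.
Qed.

(** Going from [h.+1] to 1 with [u] up steps takes [u + h] down steps, hence at least [u + (u + h)]
    steps in all. *)
Lemma coef_walk_poly_small (K : numFieldType) (m h u : nat) :
  (m < u + (u + h))%N -> (walk_poly K m h.+1)`_u = 0.
Proof.
elim: m h u => [|m IHm] [|h] u lt_m.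
- by rewrite walk_poly0 coef1; case: u lt_m.
- by rewrite walk_poly0 coef0.
- by rewrite coef_walk_polyS1; case: u lt_m => // u lt_m; apply: IHm; lia.
rewrite coef_walk_polyS !IHm ?addr0; [|lia..].
by case: u lt_m => // u lt_m; apply: IHm; lia.
Qed.

Lemma coef_walk_poly (K : numFieldType) (m h u l : nat) :
  m = (u + (u + h) + l)%N -> (walk_poly K m h.+1)`_u = ballot K u (u + h) l.
Proof.
elim: m h u l => [|m IHm] h u l.
  move=> /esym/eqP; rewrite !addn_eq0.
  case/andP=> /andP[/eqP-> /andP[_ /eqP->]] /eqP->.
  by rewrite walk_poly0 coef1 /ballot mul0r subr0 mulr1.
case: h => [|h] def_m.
  rewrite coef_walk_polyS1; case: u def_m => [|u] def_m.
    (* At height 1 without up steps no first step exists; the closed form vanishes too, through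
       ['C(l, l.+1)]. *)
    case: l def_m => [|l _]; first by lia.
    by rewrite /ballot /= mul0r subr0 [X in _ * X%:R]bin_small ?mulr0.
  by rewrite (IHm 1%N u l) ?addn1 ?addn0 ?ballot_diag //; lia.
rewrite coef_walk_polyS addnS ballot_rec; congr (_ + _ + _).
- case: u def_m => // u def_m.
  by rewrite (IHm _ _ l) ?addSnnS ?addnS //; lia.
(* If [l = 0], a level step leaves one step too few for the forced up and down steps. *)
- case: l def_m => [|l] def_m; first by apply: coef_walk_poly_small; lia.
  by rewrite (IHm _ _ l) ?addnS //; lia.
- by apply: IHm; lia.
Qed.

Definition riordan_coef (K : numFieldType) (n i : nat) : K :=
  i%:R^-1 * 'C(n - 1, i - 1)%:R * 'C(n - 2 - i, i - 1)%:R.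

(** Multiplied by [i.+1], the two products become [(i + l).+2] and [(i + l).+1] times
    ['C(m, i) * 'C(i + l, l)], and these factors differ by 1. *)
Lemma ballot_diagE (K : numFieldType) (i l : nat) :
  ballot K i.+1 i.+1 l = riordan_coef K (i.+1 + i.+1 + l).+1 i.+1.
Proof.
rewrite /ballot /riordan_coef !subn1 subn2 /= addSn /=.
set m := (i.+1 + i.+1 + l)%N; have -> : (m.-1 - i.+1 = i + l)%N by lia.
rewrite -[in RHS](bin_sub (leq_addr l i)) addKn.
have e1 : i.+1%:R * 'C((i + l).+1, l)%:R = (i + l).+1%:R * 'C(i + l, l)%:R :> K.
  by rewrite -!natrM (mul_bin_down (i + l).+1) -addSn addnK.
have e2 : i.+1%:R * 'C(m, i.+1)%:R = (i + l).+2%:R * 'C(m, i)%:R :> K.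
  by rewrite -!natrM mul_bin_left; congr (_ * _)%:R; lia.
have i_neq0 : i.+1%:R != 0 :> K by rewrite pnatr_eq0.
apply: (mulfI i_neq0); rewrite mulrBr mulrA e2 mulrCA e1 !mulrA mulfV //.
by rewrite -[(i + l).+2]addn1 natrD; ring.
Qed.

Lemma coef_asc_poly (K : numFieldType) (n i : nat) : (2 <= n)%N ->
  (asc_poly K n)`_i = if (0 < i < ((n - 1) %/ 2).+1)%N then riordan_coef K n i else 0.
Proof.
move=> n_ge2; rewrite asc_poly_walk //; case: ifP => [i_in|].
  case: i i_in => // i i_in.
  (* The steps that go neither up nor down are the level ones. *)
  rewrite (@coef_walk_poly _ _ 0 _ (n.-1 - (i.+1 + i.+1))); last by lia.
  by rewrite addn0 ballot_diagE; congr riordan_coef; lia.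
case: i => [|i] i_out.
  case: n n_ge2 i_out => [|[|n]] // _ _.
  by rewrite (@coef_walk_poly _ _ 0 _ n.+1) // /ballot /= mul0r subr0 [X in _ * X%:R]bin_small ?mulr0.
by apply: coef_walk_poly_small; lia.
Qed.

Lemma asc_polyE (K : numFieldType) (n : nat) : (2 <= n)%N ->
  asc_poly K n = \sum_(1 <= i < ((n - 1) %/ 2).+1) riordan_coef K n i *: 'X^i.
Proof.
move=> n_ge2; apply/polyP => i; rewrite coef_asc_poly // coef_sum.
rewrite (eq_bigr (fun j => if j == i then riordan_coef K n j else 0)).
  by rewrite -big_mkcond big_nat1_eq.
by move=> j _; rewrite coefZ coefXn eq_sym mulr_natr mulrb.
Qed.

(** * The hypergeometric series *)

Lemma pochhammer_opp (K : numFieldType) (m k : nat) :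
  pochhammer (- m%:R : K) k = (-1) ^+ k * (m ^_ k)%:R.
Proof.
elim: k => [|k IHk]; first by rewrite /pochhammer big_ord0 mulr1.
rewrite /pochhammer big_ord_recr /= -/(pochhammer _ _) IHk exprS ffactnSr natrM.
have [lt_mk|le_km] := ltnP m k; first by rewrite ffact_small // !(mul0r, mulr0).
by rewrite natrB //; ring.
Qed.

Lemma pochhammer2 (K : numFieldType) (k : nat) :
  pochhammer (2%:R : K) k = k.+1`!%:R.
Proof.
elim: k => [|k IHk]; first by rewrite /pochhammer big_ord0.
rewrite /pochhammer big_ord_recr /= -/(pochhammer _ _) IHk (factS k.+1) natrM.
by rewrite -natrD mulrC.
Qed.

Lemma pochhammer_half (K : numFieldType) (a : K) (k : nat) :
  pochhammer (a / 2%:R) k * pochhammer ((a + 1) / 2%:R) k * 4%:R ^+ k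
  = pochhammer a k.*2.
Proof.
elim: k => [|k IHk]; first by rewrite /pochhammer !big_ord0 !mulr1.
rewrite doubleS /pochhammer !big_ord_recr /= -!/(pochhammer _ _) -IHk exprS.
by rewrite -mul2n -[(2 * k).+1]addn1 natrD natrM; field.
Qed.

Lemma ffactnD (n j k : nat) : n ^_ (j + k) = (n ^_ j * (n - j) ^_ k)%N.
Proof.
elim: j n => [|j IHj] n; first by rewrite mul1n subn0.
case: n => [|n] //.
by rewrite addSn !ffactSS IHj mulnA.
Qed.

Lemma hyp3F2_termE (K : numFieldType) (n : nat) (t : K) (k : nat) : (3 <= n)%N ->
  hyp3F2_term (1 - n%:R) ((3%:R - n%:R) / 2%:R) ((4%:R - n%:R) / 2%:R)
    2%:R (3%:R - n%:R) (4%:R * t) k = riordan_coef K n k.+1 * t ^+ k.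
Proof.
case: n => [|[|[|n]]] // _; rewrite /hyp3F2_term /riordan_coef.
have -> : 1 - n.+3%:R = - n.+2%:R :> K by rewrite -[n.+3]addn1 natrD; ring.
have -> : 3%:R - n.+3%:R = - n%:R :> K by rewrite -[n.+3]addn3 natrD; ring.
have -> : 4%:R - n.+3%:R = - n%:R + 1 :> K by rewrite -[n.+3]addn3 natrD; ring.
have -> : (n.+3 - 2 - k.+1 = n - k)%N by lia.
rewrite !subn1 /= exprMn pochhammer2 !pochhammer_opp.
(* For [k > n] the lower parameter makes the denominator 0, so the term is 0 by convention; the
   coefficient contains ['C(0, k)] with [k > 0]. *)
have [lt_nk|le_kn] := ltnP n k.
  rewrite (ffact_small lt_nk) !mulr0 invr0 mulr0 mul0r.
  have -> : 'C(n - k, k) = 0%N by apply: bin_small; lia.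
  by rewrite mulr0 mul0r.
(* The merged half-integer factors form the falling factorial of [n] of length [2k]. Split at [k],
   its first half cancels the lower parameter up to sign, and its second half gives
   ['C(n - k, k)]. *)
have /esym := pochhammer_half _ (- n%:R : K) k.
rewrite pochhammer_opp -addnn exprD -expr2 sqrr_sign mul1r ffactnD -!bin_ffact.
rewrite factS !natrM.
have k_neq0 : k`!%:R != 0 :> K by rewrite pnatr_eq0 -lt0n fact_gt0.
have bin_neq0 : 'C(n, k)%:R != 0 :> K by rewrite pnatr_eq0 -lt0n bin_gt0.
have k1_neq0 : 1 + k%:R != 0 :> K by rewrite nat1r pnatr_eq0.
have sgn_neq0 : (-1) ^+ k != 0 :> K by rewrite signr_eq0.
set P2 := pochhammer _ _; set P3 := pochhammer _ _ => e.
transitivity ('C(n.+2, k)%:R * (P2 * P3 * 4%:R ^+ k)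
  / (k.+1%:R * k`!%:R * 'C(n, k)%:R * k`!%:R) * t ^+ k).
  by field; rewrite k_neq0 bin_neq0 k1_neq0 sgn_neq0.
by rewrite -e; field; rewrite k_neq0 bin_neq0 k1_neq0.
Qed.

Theorem theorem6p13 (K : numFieldType) (n : nat) (hn : (2 <= n)%N) :
  asc_poly K n =
    \sum_(1 <= i < ((n - 1) %/ 2).+1)
      (i%:R^-1 * 'C(n - 1, i - 1)%:R * 'C(n - 2 - i, i - 1)%:R) *: 'X^i
  /\ ((3 <= n)%N -> forall t : K,
       let a1 : K := 1 - n%:R in
       let a2 : K := (3%:R - n%:R) / 2%:R in
       let a3 : K := (4%:R - n%:R) / 2%:R in
       let b1 : K := 2%:R in
       let b2 : K := 3%:R - n%:R in
       let z : K := 4%:R * t in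
       cvgn (series (hyp3F2_term a1 a2 a3 b1 b2 z))
       /\ (asc_poly K n).[t] = t * hyp3F2 a1 a2 a3 b1 b2 z).
Proof.
split=> [|n_ge3 t a1 a2 a3 b1 b2 z]; first exact: asc_polyE.
set M := ((n - 1) %/ 2)%N.
have series_cst : \forall N \near \oo, series (hyp3F2_term a1 a2 a3 b1 b2 z) N
    = \sum_(0 <= k < M) riordan_coef K n k.+1 * t ^+ k.
  exists M => // N /= le_MN; rewrite /series /= (big_cat_nat _ le_MN) //=.
  rewrite [X in _ + X]big1_seq ?addr0.
    by apply: eq_bigr => k _; apply: hyp3F2_termE.
  (* Beyond [M] the second binomial vanishes, even where its upper index truncates to 0: [n_ge3]
     gives [M > 0], hence [k > 0]. *)
  move=> k; rewrite mem_index_iota /= => /andP[le_Mk _].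
  rewrite hyp3F2_termE // /riordan_coef [X in _ * X%:R]bin_small ?mulr0 ?mul0r //.
  by rewrite /M in le_Mk; lia.
split; first exact: is_cvg_near_cst series_cst.
rewrite /hyp3F2 (lim_near_cst (@norm_hausdorff _ _) series_cst).
rewrite asc_polyE // horner_sum big_add1 mulr_sumr.
by apply: eq_bigr => k _; rewrite hornerZ hornerXn exprS mulrCA.
Qed.
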